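(* Let $H$ be a real Hilbert space, $C\subseteq H$ a nonempty, convex and closed set, and $F:H\to H$ an operator such that the solution set $\Omega$ of $\mathrm{VI}(F,C)$ is nonempty. Assume that $F$ is pseudo-monotone on $H$, Lipschitz continuous with constant $L>0$ and sequentially weak-to-weak continuous, and let $0<\lambda<\frac1L$. Let $x_0\in H$ and let $x,y:[0,+\infty)\to H$ be the trajectories generated by the dynamical system $$\begin{cases} y(t)=P_C(x(t)-\lambda F(x(t)))\\ \dot x(t)+x(t)=y(t)+\lambda\left[F(x(t))-F(y(t))\right]\\ x(0)=x_0.\end{cases}$$ Then $x(t)$ and $y(t)$ converge weakly to a solution of $\mathrm{VI}(F,C)$ as $t\to+\infty$.
   Context: $\mathrm{VI}(F,C)$ is the problem of finding $x^*\in C$ such that $\langle F(x^* ),x-x^*\rangle\ge 0$ for all $x\in C$; $\Omega$ denotes its solution set. $P_C$ is the metric projection onto $C$. $F$ is pseudo-monotone on a set $S\subseteq H$ if for all $x,y\in S$: $\langle F(x),y-x\rangle\ge 0\Rightarrow\langle F(y),y-x\rangle\ge0$. $F$ is Lipschitz continuous with constant $L$ if $\|F(x)-F(y)\|\le L\|x-y\|$ for all $x,y\in H$. $F$ is sequentially weak-to-weak continuous if $x_n\rightharpoonup x$ implies $F(x_n)\rightharpoonup F(x)$. It is known (by the global Cauchy-Lipschitz theorem) that the dynamical system has a unique trajectory $x\in C^1([0,+\infty),H)$. *)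

(* Defs.v *)
From HB Require Import structures.
From mathcomp Require Import all_boot all_order all_algebra.
From mathcomp Require Import all_classical all_reals all_analysis.
Import Order.TTheory GRing.Theory Num.Theory.
Import numFieldNormedType.Exports.

Set Implicit Arguments.
Unset Strict Implicit.
Unset Printing Implicit Defensive.

Local Open Scope classical_set_scope.
Local Open Scope ring_scope.

(* A real Hilbert space is a complete normed module [H] over [R : realType]
   together with an inner product [ip] such that [induces_norm ip]. *)

Section Hilbert.
Context {R : realType} {H : completeNormedModType R}.
Variable ip : {dot H for (@idfun R)}.

Definition induces_norm : Prop := forall u : H, `|u| = Num.sqrt (ip u u).

Definition weak_cvg_to (G : set_system H) (l : H) : Prop :=
  forall z : H, ip u z @[u --> G] --> ip l z.

Definition seq_weak_continuous (F : H -> H) : Prop :=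
  forall (u : nat -> H) (l : H),
    weak_cvg_to (u n @[n --> \oo]) l -> weak_cvg_to (F (u n) @[n --> \oo]) (F l).

Definition VI_sol (F : H -> H) (C : set H) : set H :=
  [set p | C p /\ forall q, C q -> 0 <= ip (F p) (q - p)].

Definition pseudo_monotone (S : set H) (F : H -> H) : Prop :=
  forall u v, S u -> S v -> 0 <= ip (F u) (v - u) -> 0 <= ip (F v) (v - u).

End Hilbert.

Section Trajectories.
Context {R : realType} {H : completeNormedModType R}.

Definition nearest_points (C : set H) (u : H) : set H :=
  [set p | C p /\ forall q, C q -> `|u - p| <= `|u - q|].

(* In a Hilbert space, [nearest_points C u] is a singleton when [C] is nonempty,
   closed and convex; the default value [u] is then irrelevant. *)
Definition metric_proj (C : set H) (u : H) : H := xget u (nearest_points C u).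

(* Functions on [0, +oo) are represented by functions on [R] whose values at
   negative arguments are irrelevant. The difference quotient is restricted to
   [0, +oo), so it gives the usual derivative at t > 0 and the right derivative
   at t = 0. *)
Definition has_derivative_on_halfline (x dx : R -> H) : Prop :=
  forall t : R, 0 <= t ->
    (s - t)^-1 *: (x s - x t) @[s --> within `[0, +oo[ t^'] --> dx t.

Definition is_trajectory (C : set H) (F : H -> H) (lambda : R) (x0 : H)
    (x y : R -> H) : Prop :=
  (exists dx : R -> H,
    [/\ has_derivative_on_halfline x dx,
        {within `[0, +oo[, continuous dx} &
        forall t : R, 0 <= t ->
          y t = metric_proj C (x t - lambda *: F (x t)) /\
          dx t + x t = y t + lambda *: (F (x t) - F (y t))]) /\
  x 0 = x0.

End Trajectories.

(* Main.v *)
(* For a solution [z], projecting and pseudo-monotonicity give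
   [d/dt |x - z|^2 <= - 2 (1 - lambda L) |x - y|^2]. Hence [|x(t) - z|]
   converges, the trajectory is bounded, and, [|x - y|] being Lipschitz in time,
   a Barbalat argument yields [|x(t) - y(t)| --> 0]. Along any sequence of times
   tending to infinity, weak sequential compactness provides a weak limit point
   [p]; testing the projection inequality and using Minty's trick shows that
   [p] is a solution, and Opial's argument shows that [p] is unique. *)

Require Import Defs.
From HB Require Import structures.
From mathcomp Require Import all_boot all_order all_algebra.
From mathcomp Require Import all_classical all_reals all_analysis.
From mathcomp Require Import ring lra.
Import Order.TTheory GRing.Theory Num.Theory.
Import numFieldNormedType.Exports.

Local Open Scope classical_set_scope.
Local Open Scope ring_scope.

(** * Preliminaries on segments, norm limits and continuity *)

Lemma convex_set_line {R : realType} {V : lmodType R} (C : set V) (p q : V)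
    (t : R) : convex_set C -> C p -> C q -> 0 <= t -> t <= 1 ->
  C (p + t *: (q - p)).
Proof.
move=> cC Cp Cq t0 t1.
have := cC q p (Itv01 t0 t1); rewrite !inE => /(_ Cq Cp).
rewrite /conv /= [X in C X](_ : _ = p + t *: (q - p))//.
by rewrite /= scalerBl scale1r scalerBr addrCA.
Qed.

Lemma cvg_dist0P {R : realType} {V : normedModType R} {T} {G : set_system T}
    {FG : Filter G} (f : T -> V) (a : V) :
  f @ G --> a <-> `|f t - a| @[t --> G] --> 0.
Proof.
split=> /cvgrPdist_lt h; apply/cvgrPdist_lt => e e0; have := h e e0;
  by apply: filterS => t; rewrite sub0r normrN normr_id distrC.
Qed.

Lemma norm_le_continuous {R : realType} {V W : normedModType R} (f : V -> W)
    (M : R) : (forall v w, `|f v - f w| <= M * `|v - w|) -> continuous f.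
Proof.
move=> fM v; apply/cvg_dist0P.
have h : M * `|w - v| @[w --> v] --> 0.
  rewrite -(mulr0 M); apply: cvgM; first exact: cvg_cst.
  by rewrite -(@cvg_dist0P _ _ _ (nbhs v) _ idfun v); exact: cvg_id.
by apply: (squeeze_cvgr _ (cvg_cst 0) h); apply: nearW => w; rewrite normr_ge0 fM.
Qed.

(** * Inner product *)

Section InnerProduct.
Context {R : realType} {H : completeNormedModType R}.
Context {ip : {dot H for (@idfun R)}}.
Implicit Types u v w z : H.

Lemma ipC u v : ip u v = ip v u.
Proof. by rewrite hermC expr0 mul1r. Qed.

Lemma ipDl u v w : ip (u + v) w = ip u w + ip v w.
Proof. exact: linearDl. Qed.

Lemma ipNl u w : ip (- u) w = - ip u w.
Proof. exact: linearNl. Qed.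

Lemma ipZl a u w : ip (a *: u) w = a * ip u w.
Proof. exact: linearZl_LR. Qed.

Lemma ipDr u v w : ip w (u + v) = ip w u + ip w v.
Proof. by rewrite ipC ipDl !(ipC w). Qed.

Lemma ipNr u w : ip w (- u) = - ip w u.
Proof. by rewrite ipC ipNl (ipC w). Qed.

Lemma ipZr a u w : ip w (a *: u) = a * ip w u.
Proof. by rewrite ipC ipZl (ipC w). Qed.

Lemma ip0l w : ip 0 w = 0.
Proof. exact: linear0l. Qed.

Definition ipE := (ipDl, ipDr, ipNl, ipNr, ipZl, ipZr).

Lemma ip_ge0 u : 0 <= ip u u.
Proof.
have [->|/(neq0_dnorm_gt0 (s := ip)) /ltW //] := eqVneq u 0.
by rewrite ip0l.
Qed.

Lemma ip_gt0 u : u != 0 -> 0 < ip u u.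
Proof. exact: (neq0_dnorm_gt0 (s := ip)). Qed.

Lemma ip_eq0 u : ip u u = 0 -> u = 0.
Proof.
by move=> u0; apply/eqP/negPn/negP => /ip_gt0; rewrite u0 ltxx.
Qed.

Hypothesis hip : induces_norm ip.

Lemma ipuu u : ip u u = `|u| ^+ 2.
Proof. by rewrite hip sqr_sqrtr// ip_ge0. Qed.

(** Cauchy-Schwarz: the squared norm of [ip v v *: u - ip u v *: v], a multiple of the part of [u]
    orthogonal to [v], factors as [ip v v] times the gap in the squared inequality. *)
Lemma normr_ip_le u v : `|ip u v| <= `|u| * `|v|.
Proof.
have [->|v0] := eqVneq v 0; first by rewrite ipC ip0l !normr0 mulr0.
have vv : 0 < ip v v by exact: ip_gt0.
have := ip_ge0 (ip v v *: u - ip u v *: v); rewrite !ipE (ipC v u) => h.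
have {h} : 0 <= ip v v * (ip u u * ip v v - ip u v ^+ 2).
  by apply: le_trans h _; rewrite le_eqVlt; apply/orP; left; apply/eqP; ring.
rewrite pmulr_rge0// subr_ge0 => h.
rewrite -(@ler_pXn2r _ 2) ?nnegrE ?mulr_ge0//.
by rewrite real_normK ?num_real// exprMn -!ipuu.
Qed.

Lemma ip_le u v : ip u v <= `|u| * `|v|.
Proof. by apply: le_trans (normr_ip_le u v); exact: ler_norm. Qed.

Lemma cvg_ip {T} {G : set_system T} {FG : Filter G} (f g : T -> H) a b :
  f @ G --> a -> g @ G --> b -> ip (f t) (g t) @[t --> G] --> ip a b.
Proof.
move=> fa gb; apply/cvg_dist0P => /=.
have h : `|f t - a| * `|g t| + `|a| * `|g t - b| @[t --> G] --> 0.
  rewrite -[0](_ : 0 * `|b| + `|a| * 0 = _); last by rewrite mul0r mulr0 addr0.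
  apply: cvgD; apply: cvgM.
  - by move/cvg_dist0P: fa.
  - exact: cvg_norm.
  - exact: cvg_cst.
  - by move/cvg_dist0P: gb.
apply: (squeeze_cvgr _ (cvg_cst 0) h).
apply: nearW => t; rewrite normr_ge0 /=.
have -> : ip (f t) (g t) - ip a b = ip (f t - a) (g t) + ip a (g t - b).
  by rewrite !ipE; ring.
by apply: le_trans (ler_normD _ _) _; rewrite lerD// normr_ip_le.
Qed.

Lemma weak_cvg_dist0 {T} {G : set_system T} {FG : Filter G} (f g : T -> H) p :
  `|f t - g t| @[t --> G] --> 0 -> weak_cvg_to ip (f t @[t --> G]) p ->
  weak_cvg_to ip (g t @[t --> G]) p.
Proof.
move=> fg fp w.
have h : ip (f t) w - ip (f t - g t) w @[t --> G] --> ip p w - ip 0 w.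
  apply: cvgB; first exact: fp.
  apply: cvg_ip; last exact: cvg_cst.
  by apply/cvg_dist0P; under eq_fun do rewrite subr0.
rewrite ip0l subr0 in h.
suff : ip (g t) w @[t --> G] --> ip p w by [].
rewrite (_ : (fun t => _) = fun t => ip (f t) w - ip (f t - g t) w) //.
by apply/funext => t; rewrite ipDl ipNl; ring.
Qed.

End InnerProduct.

(** * Metric projection and Riesz representation *)

Section NearestPoint.
Context {R : realType} {H : completeNormedModType R}.
Context {ip : {dot H for (@idfun R)}}.
Hypothesis hip : induces_norm ip.
Implicit Types (u v w z p q : H) (C : set H).

(* Parallelogram law: a minimizing sequence for the distance to [u] is Cauchy. *)
Lemma nearest_points_neq0 C u : C !=set0 -> convex_set C -> closed C ->
  nearest_points C u !=set0.
Proof.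
move=> [c0 Cc0] cC clC.
pose E := [set `|u - q| ^+ 2 | q in C].
have lbE : lbound E 0 by move=> _ [q _ <-]; rewrite sqr_ge0.
have infE : has_inf E by split; [exists (`|u - c0| ^+ 2), c0 | exists 0].
pose d := inf E.
have dle q : C q -> d <= `|u - q| ^+ 2.
  by move=> Cq; apply: ge_inf; [exact: infE.2|exists q].
have /choice[q /all_and2[Cq qd]] : forall n : nat,
    exists q, C q /\ `|u - q| ^+ 2 < d + n.+1%:R^-1.
  move=> n; have n0 : 0 < n.+1%:R^-1 :> R by rewrite invr_gt0.
  by have [_ [q Cq <-] qd] := inf_adherent n0 infE; exists q.
(* The midpoint of [q m] and [q n] lies in [C], so its squared distance to [u] is at least [d]; the
   two excesses over [d] then control the remaining term of the parallelogram law. *)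
have par m n : `|q m - q n| ^+ 2 <= 2 * (m.+1%:R^-1 + n.+1%:R^-1).
  have Cmn : C (q m + 2^-1 *: (q n - q m)).
    by apply: convex_set_line => //; lra.
  have := dle _ Cmn; have := qd m; have := qd n.
  rewrite -!(ipuu hip) !ipE (ipC u (q m)) (ipC u (q n)) (ipC (q n) (q m)).
  move: (ip u u) (ip (q n) u) (ip (q m) u) (ip (q m) (q m)) (ip (q m) (q n))
    (ip (q n) (q n)) (m.+1%:R^-1) (n.+1%:R^-1) (d) => *; lra.
have cvq : cvg (q n @[n --> \oo]).
  apply/cauchy_cvgP/cauchyP => e e0.
  have e4 : 0 < e ^+ 2 / 4 by rewrite divr_gt0// exprn_gt0.
  have [N _ hN] := near_infty_natSinv_lt (PosNum e4).
  exists (q N); exists N => // n /= Nn.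
  rewrite -ball_normE /ball_/= -(@ltr_pXn2r _ 2) ?nnegrE ?(ltW e0)//.
  have := par N n; have /= := hN _ Nn; have /= := hN _ (leqnn N).
  by move: (`|_| ^+ 2) (N.+1%:R^-1) (n.+1%:R^-1) (e ^+ 2) => *; lra.
move/cvg_ex : cvq => [p qp].
have Cp : C p by apply: (closed_cvg C clC _ p qp); exact: nearW.
exists p; split=> // r Cr; rewrite -(@ler_pXn2r _ 2) ?nnegrE//.
apply: le_trans (dle _ Cr); rewrite -(ipuu hip).
have h1 : ip (u - q n) (u - q n) @[n --> \oo] --> ip (u - p) (u - p).
  by apply: (cvg_ip hip); apply: cvgB => //; exact: cvg_cst.
have h2 : d + n.+1%:R^-1 @[n --> \oo] --> d.
  rewrite -[X in _ --> X]addr0; apply: cvgD; first exact: cvg_cst.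
  exact: cvg_harmonic.
by apply: (ler_cvg_to h1 h2); apply: nearW => n; rewrite (ipuu hip) ltW.
Qed.

(** If the angle at [p] were acute, a short move from [p] towards [q] would stay in [C] and come
    strictly closer to [u]. *)
Lemma nearest_point_ip_le0 C u p q : convex_set C -> nearest_points C u p ->
  C q -> ip (u - p) (q - p) <= 0.
Proof.
move=> cC [Cp pmin] Cq; rewrite leNgt; apply/negP => a0.
set a := ip _ _ in a0.
have b0 : 0 <= ip (q - p) (q - p) by exact: ip_ge0.
set b := ip _ _ in b0.
(* The squared distance changes by [- 2 * t * a + t ^+ 2 * b]. This [t] stays in ]0, 1] even when
   [b = 0] or [a > b], and [t * (a + b) = a] makes the change negative. *)
pose t := a / (a + b).
have ab : 0 < a + b by lra.
have t0 : 0 < t by rewrite divr_gt0.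
have t1 : t <= 1 by rewrite ler_pdivrMr// mul1r; lra.
have := pmin _ (convex_set_line _ _ _ _ cC Cp Cq (ltW t0) t1).
rewrite -(@ler_pXn2r _ 2) ?nnegrE// -!(ipuu hip) opprD addrA.
rewrite (_ : ip (u - p - _) _ = ip (u - p) (u - p) - 2 * t * a + t ^+ 2 * b);
  last by rewrite /a /b !ipE (ipC q u) (ipC q p) (ipC p u); ring.
have tab : t * (a + b) = a by rewrite /t divfK// gt_eqF.
have : 0 < t * a by exact: mulr_gt0.
have : 0 < t * t by exact: mulr_gt0.
nra.
Qed.

Lemma metric_projP C u : C !=set0 -> convex_set C -> closed C ->
  C (metric_proj C u) /\
  forall q, C q -> ip (u - metric_proj C u) (q - metric_proj C u) <= 0.
Proof.
move=> C0 cC clC.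
have [p pP] := nearest_points_neq0 C u C0 cC clC.
have P : nearest_points C u (metric_proj C u) by exact: xgetI pP.
by split=> [|q Cq]; [exact: P.1|exact: nearest_point_ip_le0 P Cq].
Qed.

(** Adding the obtuse-angle inequalities of the two projections, each tested at the other one, gives
    firm nonexpansiveness; Cauchy-Schwarz finishes. *)
Lemma metric_proj_nonexpansive C u v : C !=set0 -> convex_set C -> closed C ->
  `|metric_proj C u - metric_proj C v| <= `|u - v|.
Proof.
move=> C0 cC clC.
have [Cu /(_ (metric_proj C v)) hu] := metric_projP C u C0 cC clC.
have [Cv /(_ (metric_proj C u) Cu) hv] := metric_projP C v C0 cC clC.
move/(_ Cv): hu; move: (metric_proj C u) (metric_proj C v) hv => pu pv hv hu.
have h1 : ip (pu - pv) (pu - pv) <= ip (u - v) (pu - pv).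
  by move: hu hv; rewrite !ipE; lra.
have [->|n0] := eqVneq `|pu - pv| 0; first by [].
have n1 : 0 < `|pu - pv| by rewrite lt_neqAle eq_sym n0 /=.
rewrite -(ler_pM2r n1) -expr2 -(ipuu hip).
exact: le_trans h1 (ip_le hip _ _).
Qed.

(** Take for [w] the projection of [z] onto [W]: on a subspace the obtuse-angle inequality holds for
    both [v] and [- v], hence is an equality. *)
Lemma subspace_decomposition (W : set H) z : closed W -> W 0 ->
  (forall v w, W v -> W w -> W (v + w)) -> (forall a v, W v -> W (a *: v)) ->
  exists2 w, W w & forall v, W v -> ip (z - w) v = 0.
Proof.
move=> clW W0 WD WZ.
have cW : convex_set W.
  by move=> v w t; rewrite !inE => Wv Ww; apply: WD; exact: WZ.
have [w wP] := nearest_points_neq0 W z (ex_intro _ 0 W0) cW clW.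
exists w => [|v Wv]; first exact: wP.1.
have hv a : ip (z - w) (a *: v) <= 0.
  have := nearest_point_ip_le0 W z w (w + a *: v) cW wP (WD _ _ wP.1 (WZ _ _ Wv)).
  by rewrite addrAC subrr add0r.
apply/eqP; rewrite eq_le; have := hv 1; have := hv (-1).
by rewrite !ipZr; lra.
Qed.

(** If [l] is nonzero, a vector [p] orthogonal to the kernel with [l p != 0] represents [l] up to
    scaling, because [v - (l v / l p) *: p] lies in the kernel. *)
Lemma riesz_representation (l : H -> R) (M : R) :
  (forall v w, l (v + w) = l v + l w) -> (forall a v, l (a *: v) = a * l v) ->
  (forall v, `|l v| <= M * `|v|) -> exists p, forall v, l v = ip p v.
Proof.
move=> lD lZ lM.
have l0 : l 0 = 0 by rewrite -(scale0r 0) lZ mul0r.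
have lB v w : l (v - w) = l v - l w by rewrite lD -scaleN1r lZ mulN1r.
pose W : set H := [set v | l v = 0].
have lcont : continuous l.
  by apply: (norm_le_continuous _ M) => v w; rewrite -lB.
have clW : closed W.
  apply: (@closed_comp _ _ l [set 0]); first by move=> *; exact: lcont.
  exact: closed_eq.
have WD v w : W v -> W w -> W (v + w) by rewrite /W/= lD => -> ->; rewrite addr0.
have WZ a v : W v -> W (a *: v) by rewrite /W/= lZ => ->; rewrite mulr0.
have [lz|] := pselect (forall v, l v = 0).
  by exists 0 => v; rewrite ip0l lz.
move/existsNP => [z /eqP lz].
have [w Ww wP] := subspace_decomposition W z clW l0 WD WZ.
have lp : l (z - w) = l z by rewrite lB Ww subr0.
move: (z - w) wP lp => p wP lp.
have p0 : ip p p != 0.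
  by apply/negP => /eqP /(ip_eq0) p0; move: lz; rewrite -lp p0 l0 eqxx.
exists ((l p / ip p p) *: p) => v.
have /wP : W (v - (l v / l p) *: p).
  by rewrite /W/= lB lZ lp divfK// subrr.
rewrite !ipE => /eqP; rewrite subr_eq0 => /eqP ->.
by rewrite lp; field; rewrite lz p0.
Qed.

End NearestPoint.

(** * Weak sequential compactness *)

Section WeakCompactness.
Context {R : realType} {H : completeNormedModType R}.
Context {ip : {dot H for (@idfun R)}}.
Hypothesis hip : induces_norm ip.

(** Compactness provides a cluster point, and an ultrafilter converges to its cluster points: it
    contains each neighbourhood or its complement, and clustering excludes the complement. *)
Lemma ultra_bounded_cvg {T} (U : set_system T) (FU : UltraFilter U)
    (f : T -> R) (M : R) : (forall t, `|f t| <= M) ->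
  exists r : R, f @ U --> r.
Proof.
move=> fM.
have cM : compact `[-M, M] by exact: segment_compact.
have [|r [_ clr]] := cM (f @ U) _.
  by apply: nearW => t; rewrite /= in_itv /= -ler_norml.
exists r; apply/cvgrPdist_lt => e e0.
have [//|UC] := in_ultra_setVsetC [set t | `|r - f t| < e] FU.
have fUC : (f @ U) (f @` ~` [set t | `|r - f t| < e]).
  by apply: (@filterS _ U _ _ _ _ UC) => t ht; exists t.
by have [_ [[t ht <-]] /ht] := clr _ _ fUC (nbhsx_ballx r e e0).
Qed.

(* The limits of [ip (u n) z] along an ultrafilter are represented by a point
   [p]. A subsequence [u \o s] that approaches [p] when tested against [p] and
   against every [u j] converges weakly, since the [z] on which it does so form
   a closed subspace whose orthogonal complement sees neither [u] nor [p]. *)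
Lemma bounded_weak_cvg_subseq (u : nat -> H) (M : R) :
  (forall n, `|u n| <= M) ->
  exists (s : nat -> nat) (p : H), (forall k, (k <= s k)%N) /\
    weak_cvg_to ip (u (s k) @[k --> \oo]) p.
Proof.
move=> uM.
have M0 : 0 <= M by exact: le_trans (uM 0%N).
have [U [UF oU]] := ultraFilterLemma eventually_filter.
have FU : ProperFilter U by exact: ultra_proper.
have ipM z n : `|ip (u n) z| <= M * `|z|.
  by apply: le_trans (normr_ip_le hip _ _) _; exact: ler_wpM2r.
have /choice[l lP] : forall z, exists r : R, ip (u n) z @[n --> U] --> r.
  by move=> z; exact: ultra_bounded_cvg (ipM z).
have [p lp] : exists p, forall v, l v = ip p v.
  apply: (riesz_representation hip l M) => [v w|a v|v].
  - apply: (norm_cvg_unique (lP (v + w))).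
    by rewrite /=; under eq_fun do rewrite ipDr; exact: cvgD.
  - apply: (norm_cvg_unique (lP (a *: v))).
    by rewrite /=; under eq_fun do rewrite ipZr; apply: cvgM => //; exact: cvg_cst.
  - by apply: (cvgr_to_le (cvg_norm (lP v))); exact: nearW.
have lim0 z e : 0 < e -> \forall n \near U, `|ip (u n - p) z| < e.
  move=> e0; have /cvgrPdist_lt/(_ e e0) := lP z; apply: filterS => n.
  by rewrite lp distrC !ipE.
have lim0m m e : 0 < e ->
    \forall n \near U, forall j, (j < m)%N -> `|ip (u n - p) (u j)| < e.
  move=> e0; elim: m => [|m IH]; first exact: nearW.
  have := lim0 (u m) e e0; move: IH; apply: filterS2 => n h1 h2 j.
  by rewrite ltnS leq_eqVlt => /predU1P[->//|]; exact: h1.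
(* Only finitely many conditions are imposed at stage [k], so their intersection still belongs to
   [U] and is nonempty. The map [s] need not be increasing; [k <= s k] is enough to reach
   infinity. *)
have /choice[s sP] : forall k, exists n, [/\ (k <= n)%N,
    `|ip (u n - p) p| < k.+1%:R^-1 &
    forall j, (j < k)%N -> `|ip (u n - p) (u j)| < k.+1%:R^-1].
  move=> k; have k0 : 0 < k.+1%:R^-1 :> R by rewrite invr_gt0.
  have h1 : \forall n \near U, (k <= n)%N by apply: oU; exists k.
  have [n [[kn np] nu]] :=
    filter_ex (filterI (filterI h1 (lim0 p _ k0)) (lim0m k _ k0)).
  by exists n.
exists s, p; split=> [k|]; first by case: (sP k).
pose W : set H := [set z | ip (u (s k) - p) z @[k --> \oo] --> 0].
have Wp : W p.
  apply/cvg_dist0P; apply: (squeeze_cvgr _ (cvg_cst 0) (@cvg_harmonic R)).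
  by apply: nearW => k; rewrite subr0 normr_ge0 ltW//; case: (sP k).
have Wu j : W (u j).
  apply/cvg_dist0P; apply: (squeeze_cvgr _ (cvg_cst 0) (@cvg_harmonic R)).
  exists j.+1 => // k /= jk; rewrite subr0 normr_ge0 ltW//.
  by case: (sP k) => _ _; exact.
have W0 : W 0.
  by rewrite /W/=; under eq_fun do rewrite ipC ip0l; exact: cvg_cst.
have WD v w : W v -> W w -> W (v + w).
  move=> Wv Ww; rewrite /W/=; under eq_fun do rewrite ipDr.
  by have h := cvgD Wv Ww; rewrite addr0 in h; exact: h.
have WZ a v : W v -> W (a *: v).
  move=> Wv; rewrite /W/=; under eq_fun do rewrite ipZr.
  by have h := cvgM (cvg_cst a) Wv; rewrite mulr0 in h; exact: h.
have clW : closed W.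
  move=> z clz; apply/cvgrPdist_lt => e e0.
  (* [K] bounds all [u (s k) - p] at once, so replacing [z] by a nearby [w] in [W] costs at most
     [e / 2]; the summand 1 keeps [K] positive. *)
  pose K := M + `|p| + 1.
  have K0 : 0 < K by rewrite /K; have := normr_ge0 p; lra.
  have eK : 0 < e / (2 * K) by rewrite divr_gt0// mulr_gt0.
  have [w [Ww]] := clz _ (nbhsx_ballx z _ eK).
  rewrite -ball_normE /ball_/= => zw.
  have e2 : 0 < e / 2 by rewrite divr_gt0.
  have /cvgrPdist_lt/(_ _ e2) := Ww; apply: filterS => k; rewrite !sub0r !normrN.
  move=> h; rewrite -[z](subrK w) ipDr addrC.
  apply: le_lt_trans (ler_normD _ _) _; rewrite [e]splitr ltr_leD//.
  apply: le_trans (normr_ip_le hip _ _) _.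
  have -> : e / 2 = K * (e / (2 * K)) by field; rewrite gt_eqF.
  apply: ler_pM => //; last exact: ltW.
  by apply: le_trans (ler_normB _ _) _; rewrite /K; have := uM (s k); lra.
move=> z.
have [w Ww zw] := subspace_decomposition hip W z clW W0 WD WZ.
suff : ip (u (s k)) z @[k --> \oo] --> ip p z by [].
have h := cvgD Ww (cvg_cst (ip p z)); rewrite add0r in h.
rewrite (_ : (fun k => _) = fun k => ip (u (s k) - p) w + ip p z); first exact: h.
apply/funext => k.
have := zw _ Wp; have := zw _ (Wu (s k)); rewrite !ipE => h1 h2.
by rewrite (ipC _ z) (ipC p z) (ipC _ w) (ipC p w); lra.
Qed.

End WeakCompactness.

(** * Variational inequalities *)

Lemma cvg_harmonic_path {R : realType} {V : normedModType R} (q v : V) :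
  q + n.+1%:R^-1 *: v @[n --> \oo] --> q.
Proof.
have h := cvgD (cvg_cst q) (cvgZ (@cvg_harmonic R) (cvg_cst v)).
by rewrite scale0r addr0 in h; exact: h.
Qed.

Section VariationalInequality.
Context {R : realType} {H : completeNormedModType R}.
Context {ip : {dot H for (@idfun R)}}.
Hypothesis hip : induces_norm ip.
Context {C : set H}.
Hypotheses (C0 : C !=set0) (cC : convex_set C) (clC : closed C).

(** Weak convergence is tested in the single direction [p - P], with [P] the projection of [p]: the
    obtuse-angle inequality at each [u n] passes to the limit and forces [p = P]. *)
Lemma weak_cvg_closed_convex (u : nat -> H) (p : H) :
  (forall n, C (u n)) -> weak_cvg_to ip (u n @[n --> \oo]) p -> C p.
Proof.
move=> Cu up; have [CP PP] := metric_projP hip C p C0 cC clC.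
set P := metric_proj C p in CP PP.
suff /(ip_eq0) /subr0_eq -> : ip (p - P) (p - P) = 0 by [].
apply/eqP; rewrite eq_le ip_ge0 andbT ipDl.
have h : ip (u n) (p - P) + ip (- P) (p - P) @[n --> \oo] -->
    ip p (p - P) + ip (- P) (p - P).
  by apply: cvgD; [exact: up|exact: cvg_cst].
apply: (cvgr_to_le h); apply: nearW => n.
by rewrite -ipDl ipC; exact: PP.
Qed.

Context {F : H -> H}.
Hypothesis (Fcont : continuous F).

(** Test at points of the segment from [p] to [q], divide by the step, and let the step shrink,
    using continuity of [F] at [p]. *)
Lemma minty_VI_sol (p : H) :
  C p -> (forall q, C q -> 0 <= ip (F q) (q - p)) -> VI_sol ip F C p.
Proof.
move=> Cp hp; split=> // q Cq.
have qn := cvg_harmonic_path p (q - p).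
have h : ip (F (p + n.+1%:R^-1 *: (q - p))) (q - p) @[n --> \oo] -->
    ip (F p) (q - p).
  by apply: (cvg_ip hip); [exact: (cvg_comp _ _ qn (Fcont p))|exact: cvg_cst].
apply: (cvgr_to_ge h); apply: nearW => n /=.
have n0 : 0 < n.+1%:R^-1 :> R by rewrite invr_gt0.
have n1 : n.+1%:R^-1 <= 1 :> R by rewrite invf_le1// ler1n.
have := hp _ (convex_set_line _ _ _ _ cC Cp Cq (ltW n0) n1).
by rewrite addrAC subrr add0r ipZr pmulr_rge0.
Qed.

Context {L lambda : R}.
Hypotheses (F_lip : L.-lipschitz F) (l0 : 0 < lambda).
Hypotheses (F_pseudo : pseudo_monotone ip setT F).
Hypotheses (F_weak : seq_weak_continuous ip F).

Lemma lipschitz_le u v : `|F u - F v| <= L * `|u - v|.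
Proof. exact: (F_lip (u, v)). Qed.

(* Testing with [q + eps *: F p] makes [ip (F (v n))] eventually positive on the
   test direction, because [ip (F (v n)) (F p)] tends to [ip (F p) (F p) > 0];
   this is what makes pseudo-monotonicity applicable. *)
Lemma weak_limit_VI_sol (u v : nat -> H) (p : H) (M : R) :
  (forall n, v n = metric_proj C (u n - lambda *: F (u n))) ->
  `|u n - v n| @[n --> \oo] --> 0 -> (forall n, `|v n| <= M) ->
  weak_cvg_to ip (v n @[n --> \oo]) p -> VI_sol ip F C p.
Proof.
move=> vP uv vM vp.
have Cv n : C (v n) by rewrite vP; exact: (metric_projP hip _ _ C0 cC clC).1.
have Cp : C p by exact: weak_cvg_closed_convex vp.
(* If [F p] vanishes there is no direction in which to perturb, but [p] is then a solution at
   once. *)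
have [Fp0|Fp0] := eqVneq (F p) 0.
  by split=> // q _; rewrite Fp0 ip0l.
have a0 : 0 < ip (F p) (F p) by exact: ip_gt0.
have Fvp : ip (F (v n)) (F p) @[n --> \oo] --> ip (F p) (F p).
  exact: (F_weak v p vp (F p)).
(* The projection inequality divided by [lambda] contributes [lambda^-1], exchanging [F (u n)] for
   [F (v n)] contributes [L], and [|q| + M] bounds the distance from [q] to [v n]. *)
have lower q : C q -> forall n,
    - ((lambda^-1 + L) * (`|q| + M)) * `|u n - v n| <= ip (F (v n)) (q - v n).
  move=> Cq n.
  have := (metric_projP hip _ (u n - lambda *: F (u n)) C0 cC clC).2 q Cq.
  rewrite -vP => h.
  have qv : `|q - v n| <= `|q| + M.
    by apply: le_trans (ler_normB _ _) _; rewrite lerD2l.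
  have h1 : - (`|u n - v n| * (`|q| + M)) <= ip (u n - v n) (q - v n).
    rewrite lerNl -ipNl; apply: le_trans (ip_le hip _ _) _.
    by rewrite normrN ler_wpM2l.
  have h2 : ip (F (u n) - F (v n)) (q - v n) <= L * `|u n - v n| * (`|q| + M).
    apply: le_trans (ip_le hip _ _) _.
    by apply: ler_pM => //; exact: lipschitz_le.
  have h3 : ip (u n - v n) (q - v n) <= lambda * ip (F (u n)) (q - v n).
    by move: h; rewrite addrAC [ip (u n - v n - _) _]ipDl ipNl ipZl subr_le0.
  have h4 : lambda^-1 * ip (u n - v n) (q - v n) <= ip (F (u n)) (q - v n).
    by rewrite mulrC ler_pdivrMr// mulrC.
  have h5 : lambda^-1 * - (`|u n - v n| * (`|q| + M)) <=
      lambda^-1 * ip (u n - v n) (q - v n).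
    by rewrite ler_wpM2l// invr_ge0 ltW.
  move: h2 h4 h5; rewrite ipDl ipNl.
  move: (ip (F (u n)) _) (ip (F (v n)) _) (ip (u n - v n) _) (lambda^-1) => *.
  nra.
apply: minty_VI_sol => // q Cq.
have pert eps : 0 < eps ->
    0 <= ip (F (q + eps *: F p)) (q + eps *: F p - p).
  (* The point [w] may leave [C], which is harmless because pseudo-monotonicity holds on the whole
     space. *)
  move=> e0; set w := q + eps *: F p.
  have h : ip (F w) w + ip (- F w) (v n) @[n --> \oo] --> ip (F w) (w - p).
    rewrite ipDr ipNr -ipNl; apply: cvgD; first exact: cvg_cst.
    under eq_fun do rewrite ipC.
    by rewrite (ipC (- F w)); exact: vp.
  apply: (cvgr_to_ge h).
  have h1 : - ((lambda^-1 + L) * (`|q| + M)) * `|u n - v n| +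
      eps * ip (F (v n)) (F p) @[n --> \oo] --> eps * ip (F p) (F p).
    have h2 := cvgD (cvgM (cvg_cst (- ((lambda^-1 + L) * (`|q| + M)))) uv)
      (cvgM (cvg_cst eps) Fvp).
    by rewrite mulr0 add0r in h2; exact: h2.
  have ea : 0 < eps * ip (F p) (F p) by rewrite mulr_gt0.
  apply: (filterS _ (@cvgr_ge _ _ _ eventually_filter _ _ h1 0 ea)) => n hn.
  rewrite ipNl -ipNr -ipDr; apply: (F_pseudo (v n) w I I).
  by rewrite /w addrAC ipDr ipZr; apply: le_trans hn _; rewrite lerD2r lower.
have qn := cvg_harmonic_path q (F p).
have h : ip (F (q + n.+1%:R^-1 *: F p)) (q + n.+1%:R^-1 *: F p - p)
    @[n --> \oo] --> ip (F q) (q - p).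
  apply: (cvg_ip hip); first exact: (cvg_comp _ _ qn (Fcont q)).
  by apply: cvgB => //; exact: cvg_cst.
apply: (cvgr_to_ge h); apply: nearW => n /=.
by apply: pert; rewrite invr_gt0.
Qed.

End VariationalInequality.

(** * Functions of a real variable *)

(** Bridges difference quotients in [s --> t], as used for trajectories, and the increment form
    [h --> 0] behind [is_derive]. *)
Lemma cvg_shift_dnbhs {R : realType} (t : R) : h + t @[h --> 0^'] --> t^'.
Proof.
have c : h + t @[h --> (0 : R)] --> t.
  have : h + t @[h --> (0 : R)] --> 0 + t.
    by apply: cvgD; [exact: cvg_id|exact: cvg_cst].
  by rewrite add0r.
move=> A hA; have := c _ hA.
change ((\forall h \near (0 : R), h + t != t -> A (h + t)) ->
  \forall h \near (0 : R), h != 0 -> A (h + t)).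
apply: filterS => h hA' h0; apply: hA'.
by rewrite -subr_eq0 addrK.
Qed.

Lemma is_derive_slope {R : realType} (f : R -> R) (t d : R) :
  (s - t)^-1 * (f s - f t) @[s --> t^'] --> d -> is_derive t 1 f d.
Proof.
move=> fd.
have h : h^-1 *: ((f \o shift t) (h *: 1) - f t) @[h --> 0^'] --> d.
  have := cvg_comp _ _ (cvg_shift_dnbhs t) fd.
  by apply: cvg_trans; apply: near_eq_cvg; apply: nearW => h /=;
     rewrite addrK /shift /= [_ *: 1]mulr1.
by split; [apply/cvg_ex; exists d|exact: cvg_lim h].
Qed.

Lemma nonincreasing_ge0_cvg {R : realType} (f : R -> R) (a : R) :
  (forall s t, a <= s -> s <= t -> f t <= f s) -> (forall t, 0 <= f t) ->
  exists l : R, f t @[t --> +oo] --> l.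
Proof.
move=> fni f0; pose E := [set f t | t in [set t | a <= t]].
have infE : has_inf E.
  by split; [exists (f a), a => //=|exists 0 => _ [t _ <-]].
exists (inf E); apply/cvgrPdist_lt => e e0.
have [_ [t0 /= at0 <-] ft0] := inf_adherent e0 infE.
exists t0; split; first exact: num_real.
move=> t /ltW t0t; rewrite distrC ger0_norm.
  by rewrite ltrBlDl; apply: le_lt_trans ft0; exact: fni.
rewrite subr_ge0; apply: ge_inf; first exact: infE.2.
by exists t => //=; exact: le_trans t0t.
Qed.

(* Barbalat's argument: wherever [g >= e], [f] drops by a fixed amount on an
   interval of fixed length, which is impossible near the limit of [f]. *)
Lemma lipschitz_cvg0 {R : realType} (f g : R -> R) (a c l N : R) :
  0 < c -> 0 < N -> (forall t, 0 <= g t) -> f t @[t --> +oo] --> l ->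
  (forall s t, a <= s -> s <= t -> g s - N * (t - s) <= g t) ->
  (forall s t, a <= s -> s < t ->
    exists2 r, s <= r <= t & f t - f s <= - c * g r ^+ 2 * (t - s)) ->
  g t @[t --> +oo] --> 0.
Proof.
move=> c0 N0 g0 fl gN fg; apply/cvgrPdist_lt => e e0.
(* During a time [d], [g] loses at most [N * d = e / 2], so it stays above [e / 2] and [f] falls by
   at least [eta]; two values of [f] within [eta / 2] of [l] cannot differ that much. *)
pose d := e / (2 * N).
have d0 : 0 < d by rewrite divr_gt0// mulr_gt0.
have Nd : N * d = e / 2 by rewrite /d; field; rewrite gt_eqF.
pose eta := c * (e / 2) ^+ 2 * d.
have eta0 : 0 < eta by rewrite mulr_gt0// mulr_gt0// exprn_gt0// divr_gt0.
have eta2 : 0 < eta / 2 by rewrite divr_gt0.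
have /cvgrPdist_lt/(_ _ eta2)[T [_ hT]] := fl.
exists (Num.max a T); split; first exact: num_real.
move=> t; rewrite gt_max => /andP[ta Tt].
rewrite sub0r normrN ger0_norm// ltNge; apply/negP => eg.
have td : t < t + d by rewrite ltrDl.
have [r /andP[tr rt] h] := fg _ _ (ltW ta) td.
have gr : e / 2 <= g r.
  apply: le_trans (gN _ _ (ltW ta) tr).
  have : N * (r - t) <= N * d by rewrite ler_pM2l// lerBlDl.
  by rewrite Nd; lra.
have : c * (e / 2) ^+ 2 * d <= c * g r ^+ 2 * d.
  by rewrite ler_pM2r// ler_pM2l// lerXn2r// nnegrE// ltW// divr_gt0.
move: (hT _ Tt) (hT _ (lt_trans Tt td)); rewrite !ltr_norml.
move=> /andP[h1 h2] /andP[h3 h4]; rewrite -/eta.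
move: h; rewrite addrAC subrr add0r !mulNr.
move: (c * g r ^+ 2 * d) (eta) (f t) (f (t + d)) h1 h2 h3 h4 => *; lra.
Qed.

Lemma ge_nat_cvgy {R : realType} (tau : nat -> R) (s : nat -> nat) :
  (forall k, k%:R <= tau k) -> (forall k, (k <= s k)%N) ->
  tau (s k) @[k --> \oo] --> +oo.
Proof.
move=> tauk sk; apply/cvgryPge => A; have := nbhs_infty_ger A.
apply: filterS => k Ak; apply: le_trans Ak (le_trans _ (tauk (s k))).
by rewrite ler_nat.
Qed.

(** * Differentiation along a curve on the half-line *)

Section Derivatives.
Context {R : realType} {H : completeNormedModType R}.
Context {ip : {dot H for (@idfun R)}}.
Hypothesis hip : induces_norm ip.
Context {x dx : R -> H}.
Hypothesis xdx : has_derivative_on_halfline x dx.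

Lemma halfline_slope (t : R) : 0 < t ->
  (s - t)^-1 *: (x s - x t) @[s --> t^'] --> dx t.
Proof.
move=> t0; apply: cvg_trans (xdx t (ltW t0)); apply: cvg_app => A hA.
have pos : \forall s \near t^', 0 < s.
  by apply: nbhs_dnbhs; exact: lt_nbhsr.
have hA' : \forall s \near t^', `[0, +oo[%classic s -> A s by exact: hA.
near=> s; have s0 : 0 < s by near: s.
by apply: (near hA' s) => //; rewrite /= in_itv/= andbT ltW.
Unshelve. all: by end_near. Qed.

Lemma halfline_cvg_dnbhs (t : R) : 0 < t -> x s @[s --> t^'] --> x t.
Proof.
move=> t0.
have hs : s - t @[s --> t^'] --> 0.
  have : s - t @[s --> t] --> t - t.
    by apply: cvgB; [exact: cvg_id|exact: cvg_cst].
  by rewrite subrr => h; apply: cvg_trans h; apply: cvg_app; exact: nbhs_dnbhs.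
(* The identity holds at [s = t] too, since the outer factor [s - t] vanishes there. *)
have E : (fun s => (s - t) *: ((s - t)^-1 *: (x s - x t)) + x t) = x.
  apply/funext => s; have [->|st] := eqVneq s t.
    by rewrite subrr scale0r add0r.
  by rewrite scalerA mulfV ?subr_eq0// scale1r subrK.
have : (fun s => (s - t) *: ((s - t)^-1 *: (x s - x t)) + x t) @ t^' -->
    0 *: dx t + x t.
  by apply: cvgD; [exact: cvgZ hs (halfline_slope t t0)|exact: cvg_cst].
by rewrite E scale0r add0r.
Qed.

Lemma is_derive_ip w (t : R) : 0 < t ->
  is_derive t 1 (fun s => ip (x s) w) (ip (dx t) w).
Proof.
move=> t0; apply: is_derive_slope.
have h := cvg_ip hip _ _ _ _ (halfline_slope t t0) (cvg_cst w).
rewrite (_ : (fun s => _) = fun s => ip ((s - t)^-1 *: (x s - x t)) w).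
  exact: h.
by apply/funext => s; rewrite !ipE.
Qed.

Lemma is_derive_sqr_dist z (t : R) : 0 < t ->
  is_derive t 1 (fun s => `|x s - z| ^+ 2) (2 * ip (dx t) (x t - z)).
Proof.
move=> t0; apply: is_derive_slope.
rewrite (_ : (fun s => _) = fun s =>
  ip ((s - t)^-1 *: (x s - x t)) ((x s - z) + (x t - z))).
  rewrite (_ : 2 * _ = ip (dx t) ((x t - z) + (x t - z))).
    apply: (cvg_ip hip); first exact: halfline_slope.
    apply: cvgD; last exact: cvg_cst.
    by apply: cvgB; [exact: halfline_cvg_dnbhs|exact: cvg_cst].
  by rewrite ipDr; ring.
apply/funext => s; rewrite -!(ipuu hip) !ipE.
by rewrite (ipC (x t) (x s)) (ipC z (x s)) (ipC z (x t)); ring.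
Qed.

(** Starting strictly after 0 avoids the endpoint, where only a one-sided derivative is available;
    the estimates on trajectories accordingly start at time 1. *)
Lemma halfline_MVT (f df : R -> R) (s t : R) : 0 < s -> s < t ->
  (forall r : R, 0 < r -> is_derive r 1 f (df r)) ->
  exists2 r, s <= r <= t & f t - f s = df r * (t - s).
Proof.
move=> s0 st fdf.
have fdf' (r : R) : r \in `]s, t[ -> is_derive r 1 f (df r).
  by rewrite in_itv/= => /andP[sr _]; apply: fdf; exact: lt_trans sr.
have fc : {within `[s, t], continuous f}.
  apply: derivable_within_continuous => r; rewrite in_itv/= => /andP[sr _].
  by have [] := fdf r (lt_le_trans s0 sr).
have [r rst ->] := MVT st fdf' fc; exists r => //.
by move: rst; rewrite in_itv/= => /andP[/ltW-> /ltW->].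
Qed.

(* The scalar mean value theorem is applied to [ip (x r) (x t - x s)]. *)
Lemma halfline_lipschitz (D s t : R) : 0 < s -> s <= t ->
  (forall r, s <= r -> `|dx r| <= D) -> `|x t - x s| <= D * (t - s).
Proof.
move=> s0; rewrite le_eqVlt => /predU1P[<-|st] hD.
  by rewrite !subrr normr0 mulr0.
have [r /andP[sr rt]] := halfline_MVT _ _ s t s0 st (is_derive_ip (x t - x s)).
rewrite -ipNl -ipDl (ipuu hip) => h.
have [->|n0] := eqVneq `|x t - x s| 0.
  by rewrite mulr_ge0 ?(le_trans _ (hD s _))// subr_ge0 ltW.
have n1 : 0 < `|x t - x s| by rewrite lt_neqAle eq_sym n0 /=.
rewrite -(ler_pM2r n1) -expr2 h mulrAC ler_pM2r ?subr_gt0//.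
by apply: le_trans (ip_le hip _ _) _; rewrite ler_pM2r// hD.
Qed.

End Derivatives.

(** * Trajectories *)

Section Trajectory.
Context {R : realType} {H : completeNormedModType R}.
Context {ip : {dot H for (@idfun R)}}.
Hypothesis hip : induces_norm ip.
Context {C : set H}.
Hypotheses (C0 : C !=set0) (cC : convex_set C) (clC : closed C).
Context {F : H -> H} {L lambda : R}.
Hypotheses (L0 : 0 < L) (F_lip : L.-lipschitz F).
Hypotheses (F_pseudo : pseudo_monotone ip setT F).
Hypotheses (F_weak : seq_weak_continuous ip F).
Hypotheses (l0 : 0 < lambda) (lL : 0 < 1 - lambda * L).
Context {x y dx : R -> H}.
Hypothesis xdx : has_derivative_on_halfline x dx.
Hypothesis yE : forall t, 0 <= t -> y t = metric_proj C (x t - lambda *: F (x t)).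
Hypothesis dxE : forall t, 0 <= t ->
  dx t + x t = y t + lambda *: (F (x t) - F (y t)).

(** Split [x t - z] at [y t]. The projection inequality at [z] absorbs the term in [F (x t)],
    pseudo-monotonicity gives the sign of the term in [F (y t)], and the Lipschitz bound costs
    [lambda * L] of the squared residual. *)
Lemma dissipation (z : H) (t : R) : VI_sol ip F C z -> 0 <= t ->
  ip (dx t) (x t - z) <= - (1 - lambda * L) * `|x t - y t| ^+ 2.
Proof.
move=> [Cz zP] t0.
have [] := metric_projP hip C (x t - lambda *: F (x t)) C0 cC clC.
rewrite -yE// => Cy /(_ _ Cz) proj.
have Fy : 0 <= ip (F (y t)) (y t - z) by apply: F_pseudo => //; exact: zP.
have lip : ip (F (x t) - F (y t)) (x t - y t) <= L * `|x t - y t| ^+ 2.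
  apply: le_trans (ip_le hip _ _) _; rewrite expr2 mulrA ler_wpM2r//.
  exact: lipschitz_le F_lip _ _.
have -> : dx t = - (x t - y t) + lambda *: (F (x t) - F (y t)).
  by apply/(addIr (x t)); rewrite dxE// opprB addrAC subrK.
have -> : x t - z = (x t - y t) + (y t - z) by rewrite addrA subrK.
have proj' : lambda * ip (F (x t)) (y t - z) <= ip (x t - y t) (y t - z).
  move: proj; rewrite -[z - y t]opprB ipNr oppr_le0.
  by rewrite addrAC [ip (x t - y t - _) _]ipDl ipNl ipZl subr_ge0.
have Fy' : 0 <= lambda * ip (F (y t)) (y t - z) by rewrite mulr_ge0// ltW.
have lip' : lambda * ip (F (x t) - F (y t)) (x t - y t) <=
  lambda * (L * `|x t - y t| ^+ 2) by rewrite ler_pM2l.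
rewrite ipDl ipNl ipZl 2![ip _ (x t - y t + _)]ipDr (ipuu hip).
rewrite [ip (F (x t) - F (y t)) (y t - z)]ipDl ipNl.
move: (`|x t - y t| ^+ 2) (ip (x t - y t) (y t - z)) (ip (F (x t)) (y t - z))
  (ip (F (y t)) (y t - z)) (ip (F (x t) - F (y t)) (x t - y t))
  proj' Fy' lip' => *; nra.
Qed.

(** The mean value theorem replaces integration of the dissipation: the residual appears at one
    intermediate time, the form required by [lipschitz_cvg0]. *)
Lemma sqr_dist_decrease (z : H) (s t : R) : VI_sol ip F C z -> 1 <= s ->
  s < t -> exists2 r, s <= r <= t &
    `|x t - z| ^+ 2 - `|x s - z| ^+ 2 <=
    - (2 * (1 - lambda * L)) * `|x r - y r| ^+ 2 * (t - s).
Proof.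
move=> zP s1 st; have s0 : 0 < s by exact: lt_le_trans s1.
have [r /andP[sr rt] h] :=
  halfline_MVT _ _ s t s0 st (is_derive_sqr_dist hip xdx z).
exists r; rewrite ?sr// h ler_pM2r ?subr_gt0//.
have := dissipation z r zP (ltW (lt_le_trans s0 sr)).
move: (`|x r - y r| ^+ 2) (ip (dx r) _) => *; nra.
Qed.

Lemma sqr_dist_nonincreasing (z : H) (s t : R) : VI_sol ip F C z -> 1 <= s ->
  s <= t -> `|x t - z| ^+ 2 <= `|x s - z| ^+ 2.
Proof.
move=> zP s1; rewrite le_eqVlt => /predU1P[->//|st].
have [r _ h] := sqr_dist_decrease z s t zP s1 st.
rewrite -subr_le0; apply: le_trans h _; rewrite !mulNr oppr_le0.
by rewrite mulr_ge0 ?subr_ge0 ?(ltW st)// mulr_ge0 ?sqr_ge0// mulr_ge0// ltW.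
Qed.

Lemma sqr_dist_cvg (z : H) : VI_sol ip F C z ->
  exists l : R, `|x t - z| ^+ 2 @[t --> +oo] --> l.
Proof.
move=> zP; apply: (@nonincreasing_ge0_cvg _ _ 1) => [s t s1 st|t].
  exact: sqr_dist_nonincreasing.
exact: sqr_ge0.
Qed.

Lemma velocity_le (t : R) : 0 <= t ->
  `|dx t| <= (1 + lambda * L) * `|x t - y t|.
Proof.
move=> t0; have -> : dx t = lambda *: (F (x t) - F (y t)) - (x t - y t).
  by apply/(addIr (x t)); rewrite dxE// opprB -addrA subrK addrC.
apply: le_trans (ler_normB _ _) _.
rewrite normrZ gtr0_norm// mulrDl mul1r addrC lerD2l -mulrA ler_pM2l//.
exact: lipschitz_le F_lip _ _.
Qed.

(** * Boundedness and decay of the residual *)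

Context {z : H}.
Hypothesis zP : VI_sol ip F C z.

Lemma dist_le (t : R) : 1 <= t -> `|x t - z| <= `|x 1 - z|.
Proof.
move=> t1; rewrite -(@ler_pXn2r _ 2) ?nnegrE//.
exact: sqr_dist_nonincreasing.
Qed.

Let K := (1 + lambda * L) * `|x 1 - z| / (1 - lambda * L).

(** Dissipation bounds the squared residual by speed times distance to [z], and the speed is itself
    at most a multiple of the residual; cancelling one factor leaves [K]. *)
Lemma residual_le (t : R) : 1 <= t -> `|x t - y t| <= K.
Proof.
move=> t1; have t0 : 0 <= t by exact: le_trans t1.
have [->|n0] := eqVneq `|x t - y t| 0.
  apply: divr_ge0; last exact: ltW.
  by rewrite mulr_ge0// addr_ge0// mulr_ge0// ltW.
have n1 : 0 < `|x t - y t| by rewrite lt_neqAle eq_sym n0 /=.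
rewrite /K ler_pdivlMr// -(ler_pM2r n1).
have h : - ip (dx t) (x t - z) <= `|dx t| * `|x t - z|.
  by rewrite -ipNl -[`|dx t|]normrN; exact: (ip_le hip).
have h1 : `|dx t| * `|x t - z| <= (1 + lambda * L) * `|x t - y t| * `|x 1 - z|.
  by apply: ler_pM => //; [exact: velocity_le|exact: dist_le].
have := dissipation z t zP t0.
move: (`|x t - y t|) (ip _ _) (`|dx t| * _) (`|x 1 - z|) h h1 => *; nra.
Qed.

Lemma residual_cvg0 : `|x t - y t| @[t --> +oo] --> 0.
Proof.
have [l fl] := sqr_dist_cvg z zP.
have ll : 0 <= lambda * L by rewrite mulr_ge0// ltW.
have K0 : 0 <= K by exact: le_trans (residual_le 1 (lexx _)).
(* [D] bounds the speed from time 1 on. Then [x] is Lipschitz with constant [D] and [y] with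
   [(1 + lambda * L) * D]; the extra 1 in [N] ensures positivity. *)
pose D := (1 + lambda * L) * K.
have D0 : 0 <= D by rewrite mulr_ge0// addr_ge0.
pose N := (2 + lambda * L) * D + 1.
have N0 : 0 < N by rewrite ltr_wpDl// mulr_ge0// addr_ge0.
have c0 : 0 < 2 * (1 - lambda * L) by rewrite mulr_gt0.
apply: (lipschitz_cvg0 _ _ 1 _ l N c0 N0 _ fl) => [t|s t s1 st|s t s1 st].
- exact: normr_ge0.
- have s0 : 0 < s by exact: lt_le_trans s1.
  have t0 : 0 <= t by exact: le_trans (ltW s0) st.
  have xst : `|x t - x s| <= D * (t - s).
    apply: (halfline_lipschitz hip xdx) => // r sr.
    have r1 : 1 <= r by exact: le_trans sr.
    apply: le_trans (velocity_le r _) _; first exact: le_trans r1.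
    by rewrite /D ler_wpM2l ?addr_ge0//; exact: residual_le.
  have yst : `|y t - y s| <= (1 + lambda * L) * `|x t - x s|.
    rewrite !yE ?(ltW s0)//.
    apply: le_trans (metric_proj_nonexpansive hip _ _ _ C0 cC clC) _.
    rewrite [- (x s - _)]opprD opprK addrACA [- (lambda *: _) + _]addrC -scalerBr.
    apply: le_trans (ler_normD _ _) _.
    rewrite mulrDl mul1r lerD2l normrZ gtr0_norm// -mulrA ler_pM2l//.
    by rewrite [`|x t - _|]distrC; exact: lipschitz_le F_lip _ _.
  rewrite lerBlDr; apply: le_trans (_ : `|x t - y t| +
    (`|x t - x s| + `|y t - y s|) <= _).
    have -> : x s - y s = (x t - y t) - ((x t - x s) - (y t - y s)).
      by rewrite !opprB addrA subrKA addrC subrKA.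
    apply: le_trans (ler_normB _ _) _; rewrite lerD2l.
    exact: le_trans (ler_normB _ _) _.
  rewrite lerD2l.
  have st0 : 0 <= t - s by rewrite subr_ge0.
  apply: le_trans (_ : (2 + lambda * L) * (D * (t - s)) <= _); last first.
    by rewrite mulrA ler_wpM2r// /N lerDl.
  apply: le_trans (_ : (2 + lambda * L) * `|x t - x s| <= _).
    by rewrite (_ : 2 = 1 + 1)// -addrA mulrDl mul1r lerD2l.
  by rewrite ler_wpM2l// addr_ge0.
- exact: sqr_dist_decrease.
Qed.

(** The bound [k.+1%:R <= tau k] both sends the times to infinity and keeps them in the range from 1
    on, where the trajectory is bounded. *)
Lemma seq_weak_limit (tau : nat -> R) : (forall k, k.+1%:R <= tau k) ->
  exists (s : nat -> nat) (p : H), [/\ forall k, (k <= s k)%N, VI_sol ip F C p &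
    weak_cvg_to ip (x (tau (s k)) @[k --> \oo]) p].
Proof.
move=> tauk.
have tau1 k : 1 <= tau k by apply: le_trans (tauk k); rewrite ler1n.
pose M := `|x 1 - z| + `|z|.
have xM k : `|x (tau k)| <= M.
  rewrite -[x (tau k)](subrK z); apply: le_trans (ler_normD _ _) _.
  by rewrite lerD2r dist_le.
have [s [p [sk xp]]] := bounded_weak_cvg_subseq hip _ M xM.
exists s, p; split=> //.
have tauy : tau (s k) @[k --> \oo] --> +oo.
  by apply: ge_nat_cvgy => // k; apply: le_trans (tauk k); rewrite ler_nat.
have res : `|x (tau (s k)) - y (tau (s k))| @[k --> \oo] --> 0.
  exact: (cvg_comp _ _ tauy residual_cvg0).
apply: (weak_limit_VI_sol hip C0 cC clC _ F_lip l0 F_pseudo F_weak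
  (fun k => x (tau (s k))) (fun k => y (tau (s k))) p (M + K)).
- by apply: norm_le_continuous; exact: lipschitz_le F_lip.
- by move=> k; rewrite yE// (le_trans _ (tau1 _)).
- exact: res.
- move=> k; rewrite -[y _](subrK (x (tau (s k)))) addrC.
  apply: le_trans (ler_normD _ _) _; rewrite lerD// distrC.
  exact: residual_le.
- exact: (weak_cvg_dist0 hip _ _ _ res).
Qed.

(* Opial's argument: [ip (x t) (p - q)] converges, because it is affine in
   [`|x t - p| ^+ 2 - `|x t - q| ^+ 2]. *)
Lemma seq_weak_limit_unique (tau sigma : nat -> R) (p q : H) :
  VI_sol ip F C p -> VI_sol ip F C q ->
  tau k @[k --> \oo] --> +oo -> sigma k @[k --> \oo] --> +oo ->
  weak_cvg_to ip (x (tau k) @[k --> \oo]) p ->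
  weak_cvg_to ip (x (sigma k) @[k --> \oo]) q -> p = q.
Proof.
move=> pP qP tauy sigmay xp xq.
have [lp hp] := sqr_dist_cvg p pP; have [lq hq] := sqr_dist_cvg q qP.
have [l hl] : exists l : R, ip (x t) (p - q) @[t --> +oo] --> l.
  exists (2^-1 * (lq - lp + (ip p p - ip q q))).
  rewrite (_ : (fun t => _) = fun t =>
    2^-1 * (`|x t - q| ^+ 2 - `|x t - p| ^+ 2 + (ip p p - ip q q))).
    apply: cvgM; first exact: cvg_cst.
    by apply: cvgD; [exact: cvgB|exact: cvg_cst].
  apply/funext => t; rewrite -!(ipuu hip) !ipE (ipC p (x t)) (ipC q (x t)).
  by field.
have lpE : l = ip p (p - q).
  exact: (norm_cvg_unique (cvg_comp _ _ tauy hl) (xp (p - q))).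
have lqE : l = ip q (p - q).
  exact: (norm_cvg_unique (cvg_comp _ _ sigmay hl) (xq (p - q))).
by apply/subr0_eq/(@ip_eq0 _ _ ip); rewrite ipDl ipNl -lpE -lqE subrr.
Qed.

(** A limit point [p] is fixed along the integer times. If some [ip (x t) w] failed to tend to
    [ip p w], times keeping a gap [e] would have a weak limit point equal to [p] by uniqueness, a
    contradiction. The vanishing residual transfers the limit to [y]. *)
Lemma trajectory_weak_cvg : exists2 p : H, VI_sol ip F C p &
  weak_cvg_to ip (x t @[t --> +oo]) p /\ weak_cvg_to ip (y t @[t --> +oo]) p.
Proof.
have sub_cvgy (tau : nat -> R) (s : nat -> nat) :
    (forall k, k.+1%:R <= tau k) -> (forall k, (k <= s k)%N) ->
    tau (s k) @[k --> \oo] --> +oo.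
  by move=> h; apply: ge_nat_cvgy => k; apply: le_trans (h k); rewrite ler_nat.
have [s [p [sk pP xp]]] := seq_weak_limit (fun k => k.+1%:R) (fun k => lexx _).
have xw w : ip (x t) w @[t --> +oo] --> ip p w.
  apply: contrapT => ncvg.
  have [e e0 he] : exists2 e : R, 0 < e &
      forall A : R, exists2 t, A <= t & e <= `|ip p w - ip (x t) w|.
    apply: contrapT => nex; apply: ncvg; apply/cvgrPdist_lt => e e0.
    apply: contrapT => ne; apply: nex; exists e => // A.
    apply: contrapT => nt; apply: ne; exists A; split; first exact: num_real.
    move=> t /ltW At; rewrite ltNge; apply/negP => et; apply: nt.
    by exists t.
  have /choice[tau /all_and2[tauk taue]] : forall k : nat,
      exists t, k.+1%:R <= t /\ e <= `|ip p w - ip (x t) w|.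
    by move=> k; have [t ? ?] := he k.+1%:R; exists t.
  have [s' [q [sk' qP xq]]] := seq_weak_limit tau tauk.
  have pq : p = q.
    apply: (seq_weak_limit_unique _ _ p q pP qP _ _ xp xq).
      exact: (sub_cvgy (fun k => k.+1%:R)).
    exact: (sub_cvgy tau).
  have /cvgrPdist_lt/(_ _ e0) : ip (x (tau (s' k))) w @[k --> \oo] --> ip p w.
    by rewrite pq; exact: xq.
  by case/filter_ex => k; rewrite ltNge taue.
by exists p => //; split=> //; exact: (weak_cvg_dist0 hip _ _ _ residual_cvg0).
Qed.

End Trajectory.

Theorem theorem2p1 (R : realType) (H : completeNormedModType R)
    (ip : {dot H for (@idfun R)}) (hip : induces_norm ip)
    (C : set H) (C_nonempty : C !=set0) (C_convex : convex_set C)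
    (C_closed : closed C)
    (F : H -> H) (Omega_nonempty : VI_sol ip F C !=set0)
    (F_pseudo : pseudo_monotone ip setT F)
    (L : R) (L_gt0 : 0 < L) (F_lip : L.-lipschitz F)
    (F_weak : seq_weak_continuous ip F)
    (lambda : R) (lambda_gt0 : 0 < lambda) (lambda_lt : lambda < 1 / L)
    (x0 : H) (x y : R -> H) (hxy : is_trajectory C F lambda x0 x y) :
  exists2 p : H, VI_sol ip F C p &
    weak_cvg_to ip (x t @[t --> +oo]) p /\ weak_cvg_to ip (y t @[t --> +oo]) p.
Proof.
have [[dx [xdx _ dyn]] _] := hxy.
have [z zP] := Omega_nonempty.
have lL : 0 < 1 - lambda * L by rewrite subr_gt0 -ltr_pdivlMr.
apply: (trajectory_weak_cvg hip C_nonempty C_convex C_closed L_gt0 F_lip F_pseudo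
  F_weak lambda_gt0 lL xdx _ _ zP) => t t0; by have [] := dyn t t0.
Qed.
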